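(* Let $k \geq 2$ be an integer and let $\{F_n(k)\}_{n \geq 0}$ be any sequence of integers satisfying $F_n(k) = F_{n-1}(k) + F_{n-2}(k) + \dots + F_{n-k}(k)$ for all $n \geq k$. Let $n=a(k+1) + r$ with integers $a \geq 1$ and $-1 \leq r \leq k-1$. (i) If $r=-1$ and $v_2(F_k(k))=0$, then $v_2(F_n(k))=0$. (ii) If $r \geq 0$ and $v_2\left( \sum_{j=0}^{r} F_j(k) \binom{a+r-j-1}{a-1} 2^{r-j} \right) \leq r$, then $$v_2(F_n(k))= v_2 \left( \sum_{j=0}^{r} F_j(k) \binom{a+r-j-1}{a-1} 2^{r-j} \right).$$
   Context: $v_2$ denotes the 2-adic order (2-adic valuation) on the integers, with the convention $v_2(0)=+\infty$. *)

(* Defs.v *)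
From mathcomp Require Import all_boot all_order all_algebra.
From mathcomp Require Import constructive_ereal.

Set Implicit Arguments.
Unset Strict Implicit.
Unset Printing Implicit Defensive.

Import Order.TTheory GRing.Theory Num.Theory.
Local Open Scope ring_scope.

(* [logn 2 0] is 0, so the value +oo at 0 has to be set explicitly. *)
Definition v2 (z : int) : \bar int :=
  if z == 0 then +oo%E else ((logn 2 `|z|%N)%:Z)%:E.

(* Since i <= k <= n, the truncated subtraction [n - i] is the exact one. *)
Definition kfib_rec (k : nat) (F : nat -> int) : Prop :=
  forall n : nat, (k <= n)%N -> F n = \sum_(1 <= i < k.+1) F (n - i)%N.

(* \sum_(j=0)^r F_j 'C(a+r-j-1, a-1) 2^(r-j); for 1 <= a and j <= r, none of
   the natural-number subtractions truncates. *)
Definition kfib_sum (F : nat -> int) (a r : nat) : int :=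
  \sum_(0 <= j < r.+1)
    F j * ('C(a + r - j - 1, a - 1))%:Z * 2 ^+ (r - j).

(* Main.v *)
(** Subtracting two consecutive instances of the recurrence gives
    [F (m + k + 1) = 2 F (m + k) - F m].  Write [G a r = F (a (k + 1) + r)]; then
    [G (a + 1) (r + 1) = 2 G (a + 1) r - G a (r + 1)], and [G (a + 1) 0] is
    congruent to [- G a 0] modulo 2.  Hence modulo [2 ^ (r + 1)] the number
    [G a r] is [(-1) ^ a] times the coefficient of [x ^ r] in
    [(1 - 2 x) ^ (- a) \sum_j F j x ^ j], which is [kfib_sum F a r]. *)
Require Import Defs.
From mathcomp Require Import all_boot all_order all_algebra.
From mathcomp Require Import constructive_ereal.
From mathcomp Require Import ring zify.

Import Order.TTheory GRing.Theory Num.Theory.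
Local Open Scope ring_scope.

Lemma kfib_rec_double (k : nat) (F : nat -> int) (m : nat) :
  kfib_rec k F -> F (m + k.+1)%N = 2 * F (m + k)%N - F m.
Proof.
move=> hF; rewrite (hF (m + k.+1)%N) ?addnS; last by lia.
have := hF (m + k)%N (leq_addl _ _).
case: k hF => [|k] hF.
  by rewrite !big_geq // addn0 => ->; rewrite mulr0 subr0.
rewrite big_nat_recr //= addnK => E.
rewrite big_nat_recl //= subn1 /=.
under eq_bigr do rewrite subSS.
by rewrite E; ring.
Qed.

(* [kfib_sum F 0] has junk binomials; the coefficient of [x ^ r] at [a = 0] is
   [F r]. *)
Definition kfib_coef (F : nat -> int) (a r : nat) : int :=
  if a is 0%N then F r else kfib_sum F a r.

Lemma kfib_coef0 (F : nat -> int) (a : nat) : kfib_coef F a 0 = F 0%N.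
Proof.
by case: a => // a; rewrite /= /kfib_sum big_nat1 addn0 subn0 binn !mulr1.
Qed.

(** Multiplying the generating function at exponent [- a.+1] by 1 - 2x gives the one at exponent
    [- a]; termwise this is Pascal's rule. *)
Lemma kfib_coefSS (F : nat -> int) (a r : nat) :
  kfib_coef F a.+1 r.+1 = 2 * kfib_coef F a.+1 r + kfib_coef F a r.+1.
Proof.
rewrite /= /kfib_sum big_nat_recr //= mulr_sumr.
have -> : (a.+1 + r.+1 - r.+1 - 1 = a)%N by lia.
rewrite subn1 /= binn subnn expr0 !mulr1.
case: a => [|a] /=.
  congr (_ + _); apply: eq_big_nat => j /andP[_ jr].
  by rewrite !bin0 subSn // exprS; ring.
rewrite /kfib_sum (big_nat_recr r.+1) //=.
have -> : (a.+1 + r.+1 - r.+1 - 1 = a)%N by lia.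
rewrite subn1 /= binn subnn expr0 !mulr1 addrA -big_split /=; congr (_ + _).
apply: eq_big_nat => j /andP[_ jr].
have -> : (a.+2 + r.+1 - j - 1 = (a.+1 + r - j).+1)%N by lia.
have -> : (a.+2 + r - j - 1 = a.+1 + r - j)%N by lia.
have -> : (a.+1 + r.+1 - j - 1 = a.+1 + r - j)%N by lia.
by rewrite binS subSn // exprS PoszD; ring.
Qed.

(** The modulus can grow with [r] because the recurrence doubles the entry at [r], which lifts its
    congruence from modulus 2^(r+1) to 2^(r+2). *)
Lemma kfib_congr (k : nat) (F : nat -> int) (a r : nat) : kfib_rec k F ->
  (2 ^+ r.+1 %| F (a * k.+1 + r)%N - (-1) ^+ a * kfib_coef F a r)%Z.
Proof.
move=> hF; elim: a r => [|a IHa] r; first by rewrite expr0 mul1r subrr dvdz0.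
elim: r => [|r IHr].
  have -> : (a.+1 * k.+1 + 0 = a * k.+1 + 0 + k.+1)%N by lia.
  have := IHa 0%N; rewrite (kfib_rec_double _ _ _ hF) !kfib_coef0 => H.
  (* Nothing is known about [x], but [2 * x] vanishes modulo 2. *)
  set x := F _; set y := F _ in H *.
  have -> : 2 * x - y - (-1) ^+ a.+1 * F 0%N
            = 2 * x - (y - (-1) ^+ a * F 0%N) by rewrite exprS; ring.
  by rewrite rpredB // expr1 dvdz_mulr.
have -> : (a.+1 * k.+1 + r.+1 = a * k.+1 + r.+1 + k.+1)%N by lia.
rewrite (kfib_rec_double _ _ _ hF) kfib_coefSS.
have -> : (a * k.+1 + r.+1 + k = a.+1 * k.+1 + r)%N by lia.
set x := F _ in IHr *; have := IHa r.+1; set y := F _ => H.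
have -> : 2 * x - y - (-1) ^+ a.+1 * (2 * kfib_coef F a.+1 r + kfib_coef F a r.+1)
  = 2 * (x - (-1) ^+ a.+1 * kfib_coef F a.+1 r)
    - (y - (-1) ^+ a * kfib_coef F a r.+1) by rewrite exprS; ring.
by rewrite rpredB // [2 ^+ _]exprS dvdz_mul2l.
Qed.

(** When v2 x is at most r, the powers 2^i with i <= r+1 determine it, and each of these divides [x]
    iff it divides [y]. *)
Lemma v2_congr (x y : int) (a r : nat) :
  (2 ^+ r.+1 %| y - (-1) ^+ a * x)%Z -> (v2 x <= r%:Z%:E)%E -> v2 y = v2 x.
Proof.
rewrite /v2 => H; have [//|x0] := eqVneq x 0.
rewrite lee_fin lez_nat => xr.
have dvdE i : (i <= r.+1)%N -> (2 ^ i %| `|y|)%N = (2 ^ i %| `|x|)%N.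
  move=> ir; have {}H : (2 ^+ i %| y - (-1) ^+ a * x)%Z.
    by apply: dvdz_trans H; rewrite dvdz_exp2l.
  have E z : (2 ^ i %| `|z|)%N = (2 ^+ i %| z)%Z by rewrite dvdzE abszX.
  rewrite !E -[y](subrK ((-1) ^+ a * x)) rpredDl // -signr_odd.
  by case: (odd a); rewrite ?mulN1r ?mul1r ?rpredN.
have x_gt0 : (0 < `|x|)%N by rewrite absz_gt0.
(* Zero is divisible by 2^(r+1), whereas [x] is not. *)
have y0 : y != 0.
  apply/eqP => y0; have := dvdE r.+1 (leqnn _).
  by rewrite y0 dvdn0 pfactor_dvdn // ltnNge xr.
have y_gt0 : (0 < `|y|)%N by rewrite absz_gt0.
rewrite (negPf y0); congr (Posz _)%:E; apply/eqP; rewrite eqn_leq.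
have := dvdE _ (leqW xr); have := dvdE (logn 2 `|x|).+1 xr.
by rewrite !pfactor_dvdn // ltnn leqnn => /negbT; rewrite -leqNgt => -> ->.
Qed.

Theorem theorem9 (k : nat) (hk : (2 <= k)%N) (F : nat -> int)
    (hF : kfib_rec k F) (n a : nat) (r : int) (ha : (1 <= a)%N)
    (hr : -1 <= r <= k%:Z - 1) (hn : n%:Z = a%:Z * (k%:Z + 1) + r) :
  (r = -1 -> v2 (F k) = 0%:E -> v2 (F n) = 0%:E)
  /\
  (0 <= r -> (v2 (kfib_sum F a `|r|%N) <= r%:E)%E ->
     v2 (F n) = v2 (kfib_sum F a `|r|%N)).
Proof.
split=> [r1 Fk | r0].
  have -> : n = (a.-1 * k.+1 + k)%N by case: a ha hn => // a _; lia.
  elim: a.-1 => [//|b IHb].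
  have -> : (b.+1 * k.+1 + k = b * k.+1 + k + k.+1)%N by lia.
  (* Raising the index by k+1 preserves parity: the arguments [1 0] select sign -1 and modulus 2. *)
  rewrite (kfib_rec_double _ _ _ hF) -[RHS]IHb; apply: (v2_congr _ _ 1 0).
    by rewrite expr1 mulN1r opprK subrK dvdz_mulr.
  by rewrite IHb.
case: r r0 hr hn => // r _ _ hn /= le_r.
have -> : n = (a * k.+1 + r)%N by lia.
apply: (v2_congr _ _ a r) le_r; have := kfib_congr k F a r hF.
(* For positive [a], [kfib_coef] is [kfib_sum]. *)
by case: a ha {hn}.
Qed.
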